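(* Let $P\in\mathbb{R}^{n\times n}$ be symmetric positive semidefinite, $A\in\mathbb{R}^{m\times n}$, $c\in\mathbb{R}^n$, $b\in\mathbb{R}^m$, and let $\mathcal{K}\subseteq\mathbb{R}^m$ be a nonempty closed convex cone. Consider the quadratic cone program of minimizing $\tfrac12x^TPx+c^Tx$ subject to $Ax+z=b$, $z\in\mathcal{K}$, written as minimizing $f+g$ over $\mathcal{H}=\mathbb{R}^n\times\mathbb{R}^m$ with $$f(x,z)=\tfrac12x^TPx+c^Tx+\iota_{\{Ax+z=b\}}(x,z),\qquad g(x,z)=\iota_{\mathcal{K}}(z).$$ Then Algorithm E (defined in the context), applied to this pair $(f,g)$, coincides with Algorithm S (the SCS algorithm, defined in the context). Precisely, if both algorithms are started from the same $(p^1,s^1,r^1)\in\mathbb{R}^n\times\mathbb{R}^m\times\mathbb{R}$, then for all $k\ge1$ they generate the same $(p^k,s^k,r^k)$, the same $x^k,\tau^k,\tilde x^k,\tilde\tau^k$, and the vectors $y^k,\tilde y^k$ of Algorithm S are related to the vectors $z^k,\tilde z^k,\tilde s^k$ of Algorithm E by $y^k=s^k-z^k$ and $\tilde y^k=\tilde z^k-\tilde s^k$.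
   Context: For a proper lower semicontinuous convex function $h$ on a Euclidean space: $h^*$ is the Fenchel conjugate, $(\operatorname{rec}h)(y)=\sup_{x\in\operatorname{dom}h}(h(x+y)-h(x))$, and $\operatorname{Prox}_h(x)=\operatorname{argmin}_y(h(y)+\tfrac12\|y-x\|^2)$. $\iota_C$ is the indicator function of $C$; $\operatorname{rec}C=\{x\mid x+y\in C\ \forall y\in C\}$ is the recession cone of a closed convex set $C$; $P_C$ is the Euclidean projection onto $C$; $\mathcal{K}^{\ominus}=\{u\mid\langle x\mid u\rangle\le0\ \forall x\in\mathcal{K}\}$ and $\mathcal{K}^{\oplus}=-\mathcal{K}^{\ominus}$. Algorithm E (Douglas–Rachford algorithm for the homogeneous self-dual embedding), for $f,g$ on $\mathcal{H}=\mathbb{R}^n\times\mathbb{R}^m$. Write $\mathbf{p}^k=(p^k,s^k)$, $\mathbf{x}^k=(x^k,z^k)$, $\tilde{\mathbf{p}}^k=(\tilde p^k,\tilde s^k)$, $\tilde{\mathbf{x}}^k=(\tilde x^k,\tilde z^k)$. Given $(\mathbf{p}^k,r^k)$: 1. $\hat{\mathbf{x}}^k=P_{\operatorname{rec}(\overline{\operatorname{dom}}f)}(\mathbf{p}^k)$. 2. If $(\operatorname{rec}f)(\hat{\mathbf{x}}^k)+(\operatorname{rec}f^* )(\mathbf{p}^k-\hat{\mathbf{x}}^k)\le-r^k$, set $(\mathbf{x}^k,\tau^k)=(\hat{\mathbf{x}}^k,0)$; otherwise let $(\mathbf{x}^k,\tau^k)$ be the unique solution with $\tau^k>0$ of $\mathbf{x}^k=\tau^k\operatorname{Prox}_f(\mathbf{p}^k/\tau^k)$,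 $\tau^k-r^k=\langle\mathbf{x}^k\mid\mathbf{p}^k-\mathbf{x}^k\rangle/\tau^k$. 3. $(\tilde{\mathbf{p}}^k,\tilde r^k)=2(\mathbf{x}^k,\tau^k)-(\mathbf{p}^k,r^k)$. 4. $\bar{\mathbf{x}}^k=P_{\operatorname{rec}(\overline{\operatorname{dom}}g)}(\tilde{\mathbf{p}}^k)$. 5. If $(\operatorname{rec}g)(\bar{\mathbf{x}}^k)+(\operatorname{rec}g^* )(\tilde{\mathbf{p}}^k-\bar{\mathbf{x}}^k)\le-\tilde r^k$, set $(\tilde{\mathbf{x}}^k,\tilde\tau^k)=(\bar{\mathbf{x}}^k,0)$; otherwise let $(\tilde{\mathbf{x}}^k,\tilde\tau^k)$ be the unique solution with $\tilde\tau^k>0$ of $\tilde{\mathbf{x}}^k=\tilde\tau^k\operatorname{Prox}_g(\tilde{\mathbf{p}}^k/\tilde\tau^k)$, $\tilde\tau^k-\tilde r^k=\langle\tilde{\mathbf{x}}^k\mid\tilde{\mathbf{p}}^k-\tilde{\mathbf{x}}^k\rangle/\tilde\tau^k$. 6. $(\mathbf{p}^{k+1},r^{k+1})=(\mathbf{p}^k,r^k)+(\tilde{\mathbf{x}}^k,\tilde\tau^k)-(\mathbf{x}^k,\tau^k)$. Algorithm S (SCS). Let $M=\begin{bmatrix} P & A^T \\ -A & 0 \end{bmatrix}$ and $q=(M+I)^{-1}\begin{bmatrix} c \\ b \end{bmatrix}$. Given $(p^k,s^k,r^k)$: 1. $v^k=(M+I)^{-1}\begin{bmatrix} p^k \\ s^k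 \end{bmatrix}$. 2. $\tau^k=\big(-\beta^k+\sqrt{(\beta^k)^2-4\alpha\gamma^k}\big)/(2\alpha)$, where $\alpha=1+q^Tq$, $\beta^k=q^T\begin{bmatrix} p^k \\ s^k \end{bmatrix}-2q^Tv^k-r^k$, $\gamma^k=\Big(v^k-\begin{bmatrix} p^k \\ s^k \end{bmatrix}\Big)^Tv^k$ (the nonnegative root of $\alpha\tau^2+\beta^k\tau+\gamma^k=0$). 3. $(x^k,y^k)=v^k-\tau^kq$. 4. $\tilde x^k=2x^k-p^k$, $\tilde y^k=P_{\mathcal{K}^{\oplus}}(2y^k-s^k)$, $\tilde\tau^k=\max(2\tau^k-r^k,0)$. 5. $(p^{k+1},s^{k+1},r^{k+1})=(p^k,s^k,r^k)+(\tilde x^k,\tilde y^k,\tilde\tau^k)-(x^k,y^k,\tau^k)$. *)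

(* Defs.v *)
From mathcomp Require Import all_boot all_order all_algebra.
From mathcomp Require Import all_classical all_reals all_analysis.

Set Implicit Arguments.
Unset Strict Implicit.
Unset Printing Implicit Defensive.

Import Order.TTheory GRing.Theory Num.Theory.
Import numFieldNormedType.Exports.

Local Open Scope classical_set_scope.
Local Open Scope ring_scope.

Section Euclidean.
Context {R : realType} {d : nat}.
Implicit Types (x y u : 'cV[R]_d) (C K : set 'cV[R]_d) (h : 'cV[R]_d -> \bar R).

Definition inner x y : R := (x^T *m y) 0 0.

(* The library norm on matrices is the sup norm, hence this one. *)
Definition enorm x : R := Num.sqrt (inner x x).

Definition indicator C x : \bar R := if `[< C x >] then 0%E else +oo%E.

Definition edom h : set 'cV[R]_d := [set x | (h x < +oo)%E].

Definition conjugate h u : \bar R :=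
  ereal_sup [set ((inner x u)%:E - h x)%E | x in [set: 'cV[R]_d]].

Definition rec_fun h y : \bar R :=
  ereal_sup [set (h (x + y)%R - h x)%E | x in edom h].

Definition rec_cone C : set 'cV[R]_d :=
  [set x | forall y, C y -> C (x + y)].

Definition is_cone C : Prop := forall x (t : R), 0 < t -> C x -> C (t *: x).

Definition polar_cone K : set 'cV[R]_d :=
  [set u | forall x, K x -> inner x u <= 0].

Definition dual_cone K : set 'cV[R]_d := [set u | polar_cone K (- u)].

(* proj and prox are the sets of minimisers; "y = P_C(x)" is written
   proj C x = [set y], i.e. y is the one and only minimiser, and similarly
   for prox. *)
Definition proj C x : set 'cV[R]_d :=
  [set y | C y /\ forall z, C z -> enorm (y - x) <= enorm (z - x)].

Definition prox h x : set 'cV[R]_d :=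
  [set y | forall z, (h y + (2^-1 * enorm (y - x) ^+ 2)%:E
                      <= h z + (2^-1 * enorm (z - x) ^+ 2)%:E)%E].

End Euclidean.

Section AlgorithmE.
Context {R : realType} {d : nat}.
Implicit Types (h f g : 'cV[R]_d -> \bar R).

Definition embed_solutions h (p : 'cV[R]_d) (r : R) : set ('cV[R]_d * R) :=
  [set u | [/\ 0 < u.2,
     exists2 y, prox h (u.2^-1 *: p) = [set y] & u.1 = u.2 *: y &
     u.2 - r = inner u.1 (p - u.1) / u.2]].

(* The conditional update that Algorithm E (Douglas-Rachford for the homogeneous
   self-dual embedding) performs once for f and once for g; xhat is the
   auxiliary projection and (x, tau) the output. *)
Definition embed_step h (p : 'cV[R]_d) (r : R)
    (xhat x : 'cV[R]_d) (tau : R) : Prop :=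
  proj (rec_cone (closure (edom h))) p = [set xhat] /\
  if (rec_fun h xhat + rec_fun (conjugate h) (p - xhat)%R <= (- r)%:E)%E
  then (x, tau) = (xhat, 0)
  else embed_solutions h p r = [set (x, tau)].

Record E_iterate := EIterate {
  E_p : 'cV[R]_d; E_r : R;
  E_xhat : 'cV[R]_d; E_x : 'cV[R]_d; E_tau : R;
  E_pt : 'cV[R]_d; E_rt : R;
  E_xbar : 'cV[R]_d; E_xt : 'cV[R]_d; E_taut : R }.

Definition E_iteration f g (e : E_iterate) : Prop :=
  [/\ embed_step f (E_p e) (E_r e) (E_xhat e) (E_x e) (E_tau e),
      E_pt e = 2 *: E_x e - E_p e,
      E_rt e = 2 * E_tau e - E_r e &
      embed_step g (E_pt e) (E_rt e) (E_xbar e) (E_xt e) (E_taut e)].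

(* Iterates are numbered from 1, here and in S_run; the value of a run at 0 is irrelevant. *)
Definition E_run f g (p1 : 'cV[R]_d) (r1 : R) (e : nat -> E_iterate) : Prop :=
  [/\ E_p (e 1) = p1, E_r (e 1) = r1 &
      forall k, (1 <= k)%N ->
        [/\ E_iteration f g (e k),
            E_p (e k.+1) = E_p (e k) + E_xt (e k) - E_x (e k) &
            E_r (e k.+1) = E_r (e k) + E_taut (e k) - E_tau (e k)]].

End AlgorithmE.

Section ConeProgram.
Context {R : realType} {n m : nat}.
Variables (P : 'M[R]_n) (A : 'M[R]_(m, n)) (c : 'cV[R]_n) (b : 'cV[R]_m)
  (K : set 'cV[R]_m).

Definition psd : Prop := P^T = P /\ forall x : 'cV[R]_n, 0 <= inner x (P *m x).

(* A point (x, z) of R^n x R^m is the column col_mx x z of R^(n + m). *)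
Definition qcp_affine : set 'cV[R]_(n + m) :=
  [set w | A *m usubmx w + dsubmx w = b].

Definition qcp_f (w : 'cV[R]_(n + m)) : \bar R :=
  let x := usubmx w in
  ((2^-1 * inner x (P *m x) + inner c x)%:E + indicator qcp_affine w)%E.

Definition qcp_g (w : 'cV[R]_(n + m)) : \bar R := indicator K (dsubmx w).

(* Algorithm S below is SCS. *)
Definition scs_M : 'M[R]_(n + m) := block_mx P A^T (- A) 0.

Definition scs_q : 'cV[R]_(n + m) := invmx (scs_M + 1%:M) *m col_mx c b.

Record S_iterate := SIterate {
  S_p : 'cV[R]_n; S_s : 'cV[R]_m; S_r : R;
  S_v : 'cV[R]_(n + m); S_tau : R;
  S_x : 'cV[R]_n; S_y : 'cV[R]_m;
  S_xt : 'cV[R]_n; S_yt : 'cV[R]_m; S_taut : R }.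

Definition S_iteration (e : S_iterate) : Prop :=
  let w := col_mx (S_p e) (S_s e) in
  let v := S_v e in
  let q := scs_q in
  let alpha := 1 + inner q q in
  let beta := inner q w - 2 * inner q v - S_r e in
  let gamma := inner (v - w) v in
  [/\ v = invmx (scs_M + 1%:M) *m w,
      S_tau e = (- beta + Num.sqrt (beta ^+ 2 - 4 * alpha * gamma)) / (2 * alpha),
      col_mx (S_x e) (S_y e) = v - S_tau e *: q &
      [/\ S_xt e = 2 *: S_x e - S_p e,
          proj (dual_cone K) (2 *: S_y e - S_s e) = [set S_yt e] &
          S_taut e = Num.max (2 * S_tau e - S_r e) 0]].

Definition S_run (p1 : 'cV[R]_n) (s1 : 'cV[R]_m) (r1 : R)
    (e : nat -> S_iterate) : Prop :=
  [/\ S_p (e 1) = p1, S_s (e 1) = s1, S_r (e 1) = r1 &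
      forall k, (1 <= k)%N ->
        [/\ S_iteration (e k),
            S_p (e k.+1) = S_p (e k) + S_xt (e k) - S_x (e k),
            S_s (e k.+1) = S_s (e k) + S_yt (e k) - S_y (e k) &
            S_r (e k.+1) = S_r (e k) + S_taut (e k) - S_tau (e k)]].

End ConeProgram.

Arguments E_iterate : clear implicits.
Arguments S_iterate : clear implicits.

(* Main.v *)
Require Import Defs.
From mathcomp Require Import all_boot all_order all_algebra.
From mathcomp Require Import all_classical all_reals all_analysis.
From mathcomp Require Import ring lra.
(* Restores proj, which the library imports shadow. *)
Import Defs.

Set Implicit Arguments.
Unset Strict Implicit.
Unset Printing Implicit Defensive.

Import Order.TTheory GRing.Theory Num.Theory.
Import numFieldNormedType.Exports.

Local Open Scope classical_set_scope.
Local Open Scope ring_scope.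

(** Both updates of Algorithm E have closed forms. For f, the optimality
conditions of the proximal point say that u = (x, s - z) solves
(M + I) u = (p, s) - tau (c, b), that is u = v - tau q, and the equation for tau
becomes alpha tau^2 + beta tau + gamma = 0, where gamma = - <x_v, P x_v> <= 0 for
v = (x_v, y_v). This quadratic has a unique positive root unless gamma = 0 and
beta >= 0. In that exceptional case P x_v = 0, so v also solves the system with
P replaced by 0, which computes the projection onto rec (dom f); the inequality
tested by the algorithm then reads beta >= 0, because rec f is <c, .> on the
kernel of P and +oo off it, and rec f^* is <b, .> on the residual. Hence the test
succeeds exactly when the nonnegative root vanishes, and both branches return the
same formula. For g, the indicator of a cone, the update is the projection
together with max(r, 0), and Moreau's decomposition turns the projection onto K
into that onto the dual cone. *)

(** * The Euclidean inner product, adjoints, and continuity of matrix maps *)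

Section Inner.
Context {R : realType} {d : nat}.
Implicit Types (x y z u : 'cV[R]_d) (C : set 'cV[R]_d).

Lemma innerE x y : inner x y = \sum_i x i 0 * y i 0.
Proof. by rewrite /inner mxE; apply: eq_bigr => i _; rewrite mxE. Qed.

Lemma innerC x y : inner x y = inner y x.
Proof. by rewrite !innerE; apply: eq_bigr => i _; rewrite mulrC. Qed.

Lemma innerDl x y z : inner (x + y) z = inner x z + inner y z.
Proof. by rewrite /inner linearD/= mulmxDl mxE. Qed.

Lemma innerDr x y z : inner z (x + y) = inner z x + inner z y.
Proof. by rewrite /inner mulmxDr mxE. Qed.

Lemma innerNl x y : inner (- x) y = - inner x y.
Proof. by rewrite /inner linearN/= mulNmx mxE. Qed.

Lemma innerNr x y : inner y (- x) = - inner y x.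
Proof. by rewrite /inner mulmxN mxE. Qed.

Lemma innerZl (a : R) x y : inner (a *: x) y = a * inner x y.
Proof. by rewrite /inner linearZ/= -scalemxAl mxE. Qed.

Lemma innerZr (a : R) x y : inner y (a *: x) = a * inner y x.
Proof. by rewrite /inner -scalemxAr mxE. Qed.

Lemma inner0l x : inner 0 x = 0.
Proof. by rewrite /inner trmx0 mul0mx mxE. Qed.

Lemma inner0r x : inner x 0 = 0.
Proof. by rewrite innerC inner0l. Qed.

Definition inner_simp :=
  (innerDl, innerDr, innerNl, innerNr, innerZl, innerZr, inner0l, inner0r).

Lemma inner_ge0 x : 0 <= inner x x.
Proof. by rewrite innerE; apply: sumr_ge0 => i _; rewrite -expr2 sqr_ge0. Qed.

Lemma inner_eq0 x : inner x x = 0 -> x = 0.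
Proof.
rewrite innerE => /eqP.
rewrite psumr_eq0 => [/allP x0|i _]; last by rewrite -expr2 sqr_ge0.
apply/colP => i; rewrite mxE; apply/eqP; rewrite -sqrf_eq0 expr2.
by apply: x0; rewrite mem_index_enum.
Qed.

Lemma enorm_sqr x : enorm x ^+ 2 = inner x x.
Proof. by rewrite sqr_sqrtr // inner_ge0. Qed.

Lemma ler_enorm x y : (enorm x <= enorm y) = (inner x x <= inner y y).
Proof. by rewrite /enorm ler_sqrt // inner_ge0. Qed.

Lemma inner_continuous x : continuous (inner x).
Proof.
rewrite [inner x](_ : _ = fun z => \sum_i x i 0 * z i 0).
  2: by apply/funext => z; rewrite innerE.
have term_continuous i : continuous (fun y : 'cV[R]_d => x i 0 * y i 0).
  by move=> y; apply: continuousM; [exact: cst_continuous|exact: coord_continuous].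
by apply: continuous_big => [|i _]; [exact: add_continuous|].
Qed.

End Inner.

Lemma inner_mulmxl {R : realType} p q (B : 'M[R]_(p, q)) x y :
  inner (B *m x) y = inner x (B^T *m y).
Proof. by rewrite /inner trmx_mul mulmxA. Qed.

Lemma inner_mulmxr {R : realType} p q (B : 'M[R]_(p, q)) x y :
  inner y (B *m x) = inner (B^T *m y) x.
Proof. by rewrite innerC inner_mulmxl innerC. Qed.

Lemma inner_col_mx {R : realType} p q (x1 y1 : 'cV[R]_p) (x2 y2 : 'cV[R]_q) :
  inner (col_mx x1 x2) (col_mx y1 y2) = inner x1 y1 + inner x2 y2.
Proof. by rewrite /inner tr_col_mx mul_row_col mxE. Qed.

Lemma inner_submx {R : realType} p q (x y : 'cV[R]_(p + q)) :
  inner x y = inner (usubmx x) (usubmx y) + inner (dsubmx x) (dsubmx y).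
Proof. by rewrite -{1}[x]vsubmxK -{1}[y]vsubmxK inner_col_mx. Qed.

(** Matrix neighbourhoods are generated by entrywise ones, and there are only finitely many
    entries. *)
Lemma continuous_mx {T : topologicalType} {R : realType} p q
    (f : T -> 'M[R]_(p, q)) :
  (forall i j, continuous (fun t => f t i j)) -> continuous f.
Proof.
move=> fc t B /= [Q Qn sQB].
have : \forall u \near t, forall i j, Q i j (f u i j).
  do 2 apply: filter_forall => ?; exact: fc (Qn _ _).
by apply: (@filterS _ (nbhs t)) => u Qu; apply: sQB.
Qed.

Lemma mulmx_continuous {R : realType} p q (B : 'M[R]_(p, q)) :
  continuous (fun x : 'cV[R]_q => B *m x).
Proof.
apply: continuous_mx => i j; rewrite ord1.
rewrite (_ : (fun _ => _) = inner (row i B)^T); first exact: inner_continuous.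
by apply/funext => x; rewrite /inner trmxK -row_mul [RHS]mxE.
Qed.

Lemma dsubmx_continuous {R : realType} p q :
  continuous (dsubmx : 'cV[R]_(p + q) -> 'cV[R]_q).
Proof.
apply: continuous_mx => i j.
rewrite (_ : (fun _ => _) = fun x : 'cV[R]_(p + q) => x (rshift p i) j).
  exact: coord_continuous.
by apply/funext => x; rewrite mxE.
Qed.

Lemma trmx_continuous {R : realType} p q :
  continuous (trmx : 'M[R]_(p, q) -> 'M[R]_(q, p)).
Proof.
apply: continuous_mx => i j.
rewrite (_ : (fun _ => _) = fun x : 'M[R]_(p, q) => x j i).
  exact: coord_continuous.
by apply/funext => x; rewrite mxE.
Qed.

(** * Euclidean projections, and Moreau's decomposition for cones *)

Section Projection.
Context {R : realType} {d : nat}.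
Implicit Types (x y z : 'cV[R]_d) (C K : set 'cV[R]_d).

(** Phrased on row vectors to fit the extreme value theorem [EVT_min_rV]. *)
Lemma inner_sub_continuous x :
  continuous (fun v : 'rV[R]_d => inner (v^T - x) (v^T - x)).
Proof.
rewrite (_ : (fun _ => _) =
    fun u : 'rV[R]_d => \sum_i (u 0 i - x i 0) * (u 0 i - x i 0)).
  2: by apply/funext => u; rewrite innerE; apply: eq_bigr => i _; rewrite !mxE.
have sub_continuous i : continuous (fun u : 'rV[R]_d => u 0 i - x i 0).
  by move=> u; apply: continuousB; [exact: coord_continuous|exact: cst_continuous].
have term_continuous i :
    continuous (fun u : 'rV[R]_d => (u 0 i - x i 0) * (u 0 i - x i 0)).
  by move=> u; exact: continuousM (sub_continuous i u) (sub_continuous i u).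
by apply: continuous_big => [|i _]; [exact: add_continuous|].
Qed.

(** Entrywise this is |a| <= 1 + a^2. It makes sublevel sets of the Euclidean distance bounded for
    the sup norm. *)
Lemma ler_norm_inner (v : 'rV[R]_d) : `|v| <= 1 + inner v^T v^T.
Proof.
rewrite [`|v|]mx_normrE; apply/bigmax_leP; split=> [|[i j] _ /=].
  by rewrite addr_ge0 // inner_ge0.
have vj : v i j ^+ 2 <= inner v^T v^T.
  rewrite innerE (bigD1 j) //= !mxE (ord1 i) -expr2 lerDl.
  by apply: sumr_ge0 => k _; rewrite -expr2 sqr_ge0.
apply: le_trans (_ : 1 + v i j ^+ 2 <= _); last by rewrite lerD2l.
rewrite -real_normK ?num_real //; have := sqr_ge0 (`|v i j| - 1).
by have := normr_ge0 (v i j); nra.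
Qed.

Lemma proj_nonempty C x : closed C -> C !=set0 -> exists y, proj C x y.
Proof.
move=> Ccl [z0 Cz0].
pose f (v : 'rV[R]_d) := inner (v^T - x) (v^T - x).
(* The part of [C] no farther from [x] than [z0] is compact, and points of [C] outside it cannot
   beat its minimiser. *)
pose A := (trmx : 'rV[R]_d -> _) @^-1` C `&` f @^-1` [set r | r <= f z0^T].
have Acl : closed A.
  apply: closedI.
    by apply: (continuous_closedP trmx).1 Ccl; exact: trmx_continuous.
  apply: (continuous_closedP f).1 (@closed_le _ (f z0^T)).
  exact: inner_sub_continuous.
have Abnd : bounded_set A.
  exists (`|x^T| + (1 + f z0^T)); split; first exact: num_real.
  move=> M ltM v [_ fv]; apply: le_trans (ltW ltM).
  rewrite -[v](subrK x^T) addrC (le_trans (ler_normD _ _)) // lerD2l.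
  by rewrite (le_trans (ler_norm_inner _)) // linearB/= trmxK lerD2l.
have [||v] := EVT_min_rV (f := f) _ (bounded_closed_compact Abnd Acl).
- by exists z0^T; split; rewrite //= trmxK.
- by apply: continuous_subspaceT => v; exact: inner_sub_continuous.
rewrite inE => -[Cv fv] minv; exists v^T; split=> // z Cz.
rewrite ler_enorm; have [fz|/ltW fz] := leP (f z^T) (f z0^T).
  by have := minv z^T; rewrite inE /f trmxK; apply; split; rewrite /= ?trmxK.
by apply: le_trans fv _; move: fz; rewrite /f !trmxK.
Qed.

(** First-order optimality: if [w] made an acute angle with [x - y], a short step from [y] along [w]
    would come closer to [x]. *)
Lemma proj_obtuse C x y w : proj C x y ->
  (forall t, 0 < t <= 1 -> C (y + t *: w)) -> inner (x - y) w <= 0.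
Proof.
move=> [_ miny] Cw; rewrite leNgt; apply/negP; set a := inner _ _ => a0.
have D0 := inner_ge0 w; set D := inner w w in D0.
have aD0 : 0 < a + D by lra.
(* This step is at most 1 and satisfies t D < 2 a, so the change - 2 t a + t^2 D of the squared
   distance is negative. *)
pose t := a / (a + D).
have tE : t * (a + D) = a by rewrite mulfVK ?gt_eqF.
have t01 : 0 < t <= 1 by rewrite divr_gt0 //= ler_pdivrMr // mul1r lerDl.
have := miny _ (Cw t t01); rewrite ler_enorm.
have -> : inner (y + t *: w - x) (y + t *: w - x) =
    inner (y - x) (y - x) - 2 * t * a + t ^+ 2 * D.
  rewrite /a /D !inner_simp (innerC w y) (innerC w x); ring.
by case/andP: t01 => t0 t1; nra.
Qed.

(** The sum is twice the midpoint. *)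
Lemma cone_add_closed K : is_cone K -> @convex_set R 'cV[R]_d K ->
  forall x y, K x -> K y -> K (x + y).
Proof.
move=> Kcone Kconv x y Kx Ky.
have Kmid : K (2^-1 *: x + 2^-1 *: y).
  have half_ge0 : 0 <= 2^-1 :> R by lra.
  have half_le1 : 2^-1 <= 1 :> R by lra.
  have := @Kconv x y (Itv01 half_ge0 half_le1).
  rewrite !inE => /(_ Kx Ky); congr K; congr (_ + _ *: _).
  by rewrite /unstable.onem /=; lra.
by have := Kcone _ 2 (ltr0Sn _ _) Kmid; rewrite scalerDr !scalerA mulfV // !scale1r.
Qed.

(** [is_cone] only allows positive factors, so 0 is reached as the limit of t x for t decreasing to
    0. *)
Lemma cone_closed0 K : K !=set0 -> closed K -> is_cone K -> K 0.
Proof.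
move=> [x Kx] Kcl Kcone; rewrite -(scale0r x).
apply: (closed_cvg (F := 0^'+) (u_ := fun t : R => t *: x)) => //.
  by near=> t; apply: Kcone.
apply: cvgZr_tmp; exact: cvg_within.
Unshelve. all: by end_near. Qed.

(** From [y] one can move inside [K] along [y], [- y] and every point of [K]; [proj_obtuse] is
    applied to these directions. *)
Lemma proj_coneP K x y : K 0 -> is_cone K ->
    (forall x y, K x -> K y -> K (x + y)) -> proj K x y ->
  [/\ K y, inner (x - y) y = 0 & polar_cone K (x - y)].
Proof.
move=> K0 Kcone Kadd xy; have Ky := xy.1; split=> //.
  apply/eqP; rewrite eq_le -oppr_le0 -innerNr; apply/andP; split.
    apply: proj_obtuse xy _ => t /andP[t0 _].
    by rewrite -{1}[y]scale1r -scalerDl; apply: Kcone => //; lra.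
  apply: proj_obtuse xy _ => t /andP[_ t1].
  rewrite -{1}[y]scale1r scalerN -scalerBl.
  (* The full step along [- y] ends at 0, which positive scaling does not reach. *)
  have [->|t1'] := eqVneq t 1; first by rewrite subrr scale0r.
  by apply: Kcone => //; rewrite subr_gt0 lt_neqAle t1'.
move=> z Kz; rewrite innerC; apply: proj_obtuse xy _ => t /andP[t0 _].
by apply: Kadd => //; exact: Kcone.
Qed.

(** By orthogonality |z - x|^2 = |z - y|^2 + |y - x|^2 - 2 <z, x - y>, and the last pairing is
    nonpositive on [K]; this gives minimality and uniqueness together. *)
Lemma proj_cone_eq K x y : K y -> inner (x - y) y = 0 -> polar_cone K (x - y) ->
  proj K x = [set y].
Proof.
move=> Ky xyy Kxy.
have split_sqr z : inner (z - x) (z - x) =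
    inner (z - y) (z - y) + inner (y - x) (y - x) - 2 * inner z (x - y).
  move: xyy; rewrite !inner_simp (innerC x z) (innerC y z) (innerC y x); lra.
apply/seteqP; split=> [z [Kz minz] | z -> {z}].
  have := minz _ Ky; rewrite ler_enorm (split_sqr z) => le_zy.
  apply/subr0_eq/inner_eq0/eqP; rewrite eq_le inner_ge0 andbT.
  by have := Kxy _ Kz; lra.
split=> // z Kz; rewrite ler_enorm (split_sqr z).
by have := Kxy _ Kz; have := inner_ge0 (z - y); lra.
Qed.

(** The residual of [- x] at [y - x] is [- y], so the conditions of [proj_cone_eq] are the given
    ones with the two vectors exchanged. *)
Lemma moreau_dual K x y : K y -> inner (x - y) y = 0 -> polar_cone K (x - y) ->
  proj (dual_cone K) (- x) = [set y - x].
Proof.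
move=> Ky xyy Kxy; apply: proj_cone_eq.
- by rewrite /dual_cone /= opprB.
- by rewrite opprB addrA addNr add0r innerNl -opprB innerNr innerC xyy !oppr0.
- move=> u Ku; rewrite opprB addrA addNr add0r.
  by have := Ku _ Ky; rewrite !innerNr innerC.
Qed.

End Projection.
Lemma set1_eq {T : Type} (x y : T) : [set x] = [set y] <-> x = y.
Proof. by split=> [xy|->//]; have : [set x] x by []; rewrite xy. Qed.

(** * The update of Algorithm E for the indicator of a closed convex cone *)

Section ConeStep.
Context {R : realType} {d : nat}.
Implicit Types (x y z p u : 'cV[R]_d) (C : set 'cV[R]_d).

Lemma indicator_in C x : C x -> indicator C x = 0%E.
Proof. by move=> Cx; rewrite /indicator asboolT. Qed.

Lemma indicator_out C x : ~ C x -> indicator C x = +oo%E.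
Proof. by move=> Cx; rewrite /indicator asboolF. Qed.

Lemma edom_indicator C : edom (indicator C) = C.
Proof.
apply/seteqP; split=> x; rewrite /edom /=;
  last by move=> Cx; rewrite indicator_in // ltry.
by have [//|/indicator_out ->] := pselect (C x); rewrite ltxx.
Qed.

Lemma rec_cone_cone C : C 0 -> (forall x y, C x -> C y -> C (x + y)) ->
  rec_cone C = C.
Proof.
move=> C0 Cadd; apply/seteqP; split=> [x Cx|x Cx y Cy]; last exact: Cadd.
by have := Cx _ C0; rewrite addr0.
Qed.

Lemma rec_fun_indicator C x : C !=set0 ->
  (forall y, C y -> C (y + x)) -> rec_fun (indicator C) x = 0%E.
Proof.
move=> [z Cz] Cx; rewrite /rec_fun edom_indicator; apply/eqP; rewrite eq_le.
apply/andP; split.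
  apply: ge_ereal_sup => _ [y Cy <-].
  by rewrite !indicator_in ?sube0 //; exact: Cx.
apply: ereal_sup_ubound; exists z => //.
by rewrite !indicator_in ?sube0 //; exact: Cx.
Qed.

Lemma conjugate_indicator_cone C : C 0 -> is_cone C ->
  conjugate (indicator C) = indicator (polar_cone C).
Proof.
move=> C0 Ccone; apply/funext => u; have [Cu|Cu] := pselect (polar_cone C u).
  rewrite indicator_in //; apply/eqP; rewrite eq_le; apply/andP; split.
    apply: ge_ereal_sup => _ [x _ <-]; have [Cx|Cx] := pselect (C x).
      by rewrite indicator_in // sube0 lee_fin; exact: Cu.
    by rewrite indicator_out // addeNy leNye.
  apply: ereal_sup_ubound; exists 0 => //.
  by rewrite indicator_in // inner0l sube0.
rewrite indicator_out //.
move/existsNP: Cu => [x /not_implyP[Cx /negP]]; rewrite -ltNge => xu.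
apply/eqyP => r r0; apply: ereal_sup_ubound.
(* Scaling [x] by this factor makes its pairing with [u] equal to the arbitrary bound [r], so the
   supremum is infinite. *)
have s0 : 0 < r / inner x u by rewrite divr_gt0.
exists ((r / inner x u) *: x) => //.
by rewrite indicator_in ?sube0 ?innerZl ?mulfVK ?gt_eqF //; exact: Ccone.
Qed.

Lemma prox_indicator C x : C !=set0 -> prox (indicator C) x = proj C x.
Proof.
move=> [z0 Cz0]; apply/seteqP; split=> y; last first.
  move=> [Cy miny] z; rewrite indicator_in // add0e.
  have [Cz|Cz] := pselect (C z); last by rewrite indicator_out // addye // leey.
  rewrite indicator_in // add0e lee_fin !enorm_sqr.
  by have := miny _ Cz; rewrite ler_enorm; lra.
move=> miny; have Cy : C y.
  apply: contrapT => Cy; have := miny z0.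
  by rewrite indicator_out // indicator_in // addye // add0e leye_eq.
split=> // z Cz; have := miny z; rewrite !indicator_in // !add0e lee_fin.
by rewrite ler_enorm !enorm_sqr; lra.
Qed.

(** Both recession terms vanish, because [y] is in [C] and [p - y] in its polar cone, so the test
    reads r <= 0. When it fails, homogeneity of the projection gives x = y for every positive tau,
    and orthogonality of [p - y] to [y] reduces the scalar equation to tau = r. *)
Lemma embed_step_cone C p r y xhat x tau :
    closed C -> C 0 -> is_cone C -> (forall u v, C u -> C v -> C (u + v)) ->
    proj C p y ->
  embed_step (indicator C) p r xhat x tau <->
  [/\ xhat = y, x = y & tau = Num.max r 0].
Proof.
move=> Ccl C0 Ccone Cadd /(proj_coneP C0 Ccone Cadd)[Cy pyy polpy].
have Cn0 : C !=set0 by exists 0.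
rewrite /embed_step edom_indicator -(closure_id C).1 // rec_cone_cone //.
rewrite (proj_cone_eq Cy pyy polpy) conjugate_indicator_cone //.
have solE : 0 < r -> embed_solutions (indicator C) p r = [set (y, r)].
  move=> r0.
  have projS (t : R) : 0 < t -> prox (indicator C) (t^-1 *: p) = [set t^-1 *: y].
    move=> t0; rewrite prox_indicator //; apply: proj_cone_eq.
    - by apply: Ccone => //; rewrite invr_gt0.
    - by rewrite -scalerBr innerZl innerZr pyy !mulr0.
    - move=> z Cz; rewrite -scalerBr innerZr mulr_ge0_le0 //.
        by rewrite invr_ge0 ltW.
      exact: polpy.
  apply/seteqP; split=> [[u t] [/= t0 [z]]|_ ->].
    rewrite projS // => /set1_eq <- ->; rewrite scalerA divff ?gt_eqF // scale1r.
    by rewrite innerC pyy mul0r => /eqP; rewrite subr_eq0 => /eqP ->.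
  split=> //=; last by rewrite innerC pyy mul0r subrr.
  by exists (r^-1 *: y); [rewrite projS|rewrite scalerA divff ?gt_eqF // scale1r].
have recE : (rec_fun (indicator C) y +
    rec_fun (indicator (polar_cone C)) (p - y)%R)%E = 0%E.
  rewrite (rec_fun_indicator Cn0); last by move=> z Cz; exact: Cadd.
  rewrite rec_fun_indicator ?adde0 //; first by exists 0 => z _; rewrite inner0r.
  by move=> u Cu z Cz; rewrite innerDr; have := Cu _ Cz; have := polpy _ Cz; lra.
split=> [[/set1_eq <-]|[-> -> ->]]; rewrite recE lee_fin oppr_ge0.
  case: leP => [r0 [-> ->]|r0]; first by [].
  by rewrite solE // => /set1_eq[-> ->].
by split=> //; case: leP => // r0; rewrite solE.
Qed.

End ConeStep.

(** * Semidefinite matrices and the quadratic equation for tau *)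

Section Linear.
Context {R : realType}.

Lemma unitmx_inj p (B : 'M[R]_p) :
  (forall v : 'cV[R]_p, B *m v = 0 -> v = 0) -> B \in unitmx.
Proof.
move=> Binj; rewrite -unitmx_tr -row_free_unit -kermx_eq0.
apply/rowV0P => v /sub_kermxP vB; apply: trmx_inj; rewrite trmx0.
by apply: Binj; rewrite -[B]trmxK -trmx_mul vB trmx0.
Qed.

(** If P x were nonzero, a short step from [x] along - P x would make the quadratic form negative;
    the step length is chosen as in [proj_obtuse]. *)
Lemma psd_isotropic p (P : 'M[R]_p) x : psd P -> inner x (P *m x) = 0 ->
  P *m x = 0.
Proof.
move=> [PT Pge0] xPx; apply/inner_eq0/eqP; rewrite eq_le inner_ge0 andbT leNgt.
apply/negP; set a := inner _ _ => a0.
pose D := inner (P *m x) (P *m (P *m x)).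
have D0 : 0 <= D by exact: Pge0.
have aD0 : 0 < a + D by lra.
pose t := a / (a + D).
have tE : t * (a + D) = a by rewrite mulfVK ?gt_eqF.
have t0 : 0 < t by rewrite divr_gt0.
have := Pge0 (x - t *: (P *m x)).
rewrite mulmxBr -scalemxAr !inner_simp xPx.
rewrite [inner x (P *m (P *m x))]inner_mulmxr PT -/a -/D.
by nra.
Qed.

(** Since al ga <= 0, the square root is at least |be|, hence T >= 0. The product of the two roots
    is ga / al <= 0, which leaves no room for a second positive root. *)
Lemma positive_root (al be ga : R) : 0 < al -> ga <= 0 ->
  let T := (- be + Num.sqrt (be ^+ 2 - 4 * al * ga)) / (2 * al) in
  [/\ 0 <= T,
      forall t, 0 < t -> (al * t ^+ 2 + be * t + ga = 0) <-> t = T &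
      T = 0 <-> ga = 0 /\ 0 <= be].
Proof.
move=> al0 ga0 T; set S := Num.sqrt _ in T *.
have alga : 4 * al * ga <= 0 by nra.
have S0 : 0 <= S by exact: sqrtr_ge0.
have SS : S ^+ 2 = be ^+ 2 - 4 * al * ga.
  by rewrite sqr_sqrtr // subr_ge0 (le_trans alga) ?sqr_ge0.
have TE : 2 * al * T = - be + S by rewrite mulrC mulfVK // mulf_neq0 ?gt_eqF.
have beS : be <= S by nra.
have T0 : 0 <= T by rewrite divr_ge0; nra.
have Troot : al * T ^+ 2 + be * T + ga = 0.
  have : 4 * al * (al * T ^+ 2 + be * T + ga) = 0.
    have -> : 4 * al * (al * T ^+ 2 + be * T + ga) =
      (2 * al * T + be) ^+ 2 - (be ^+ 2 - 4 * al * ga) by ring.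
    by rewrite TE -SS; ring.
  by move/eqP; rewrite !mulf_eq0 pnatr_eq0 (gt_eqF al0) /= => /eqP.
split=> //; last first.
  split=> [T00|[ga00 be0]].
    by move: TE Troot; rewrite T00 expr0n /= !mulr0 !add0r => TE ->; split; lra.
  apply/eqP; move: Troot; rewrite ga00 addr0 => /eqP.
  rewrite expr2 mulrA -mulrDl mulf_eq0 => /orP[|//] /eqP alT; nra.
move=> t t0; split=> [troot|-> //].
have : (t - T) * (al * (t + T) + be) = 0.
  have -> : (t - T) * (al * (t + T) + be) =
    (al * t ^+ 2 + be * t + ga) - (al * T ^+ 2 + be * T + ga) by ring.
  by rewrite troot Troot subrr.
move/eqP; rewrite mulf_eq0 => /orP[|/eqP abs]; first by rewrite subr_eq0 => /eqP.
(* Vieta's formula for the two roots. It forces T = 0, so [be] equals the square root and is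
   nonnegative, against al t + be = 0. *)
have altT : al * t * T = ga.
  have -> : al * t * T =
    T * (al * (t + T) + be) - (al * T ^+ 2 + be * T + ga) + ga by ring.
  by rewrite abs Troot mulr0 subrr add0r.
have alt0 : 0 < al * t by exact: mulr_gt0.
have T00 : T = 0.
  by apply/eqP; rewrite eq_le T0 andbT -(pmulr_rle0 _ alt0) altT.
by exfalso; move: abs TE; rewrite T00 mulr0 addr0; lra.
Qed.

End Linear.

(** * Recession functions, conjugate and proximal map of the quadratic objective *)

Section QuadraticStep.
Context {R : realType} {n m : nat}.
Variables (P : 'M[R]_n) (A : 'M[R]_(m, n)) (c : 'cV[R]_n) (b : 'cV[R]_m).
Implicit Types (w u : 'cV[R]_(n + m)) (x : 'cV[R]_n) (y mu : 'cV[R]_m).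
Hypothesis P_psd : psd P.

Local Notation f := (qcp_f P A c b).
Local Notation obj x := (2^-1 * inner x (P *m x) + inner c x).

(** [Q] will be [P] for the proximal step and 0 for the projection onto the recession cone. *)
Lemma scs_M_mul (Q : 'M[R]_n) x y :
  (scs_M Q A + 1%:M) *m col_mx x y =
  col_mx (Q *m x + A^T *m y + x) (y - A *m x).
Proof.
rewrite mulmxDl mul1mx /scs_M mul_block_col add_col_mx mul0mx addr0 mulNmx.
by rewrite [- _ + y]addrC.
Qed.

(** Used with [P] and 0 to identify the solutions of the two systems on the kernel of [P]. *)
Lemma eq_scs_M_mul (Q Q' : 'M[R]_n) u : Q *m usubmx u = Q' *m usubmx u ->
  (scs_M Q A + 1%:M) *m u = (scs_M Q' A + 1%:M) *m u.
Proof. by move=> QQ'; rewrite -[u]vsubmxK !scs_M_mul QQ'. Qed.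

(** The contributions of the off-diagonal blocks cancel by skewness. *)
Lemma scs_M_inner (Q : 'M[R]_n) u :
  inner (scs_M Q A *m u) u = inner (usubmx u) (Q *m usubmx u).
Proof.
rewrite -[u]vsubmxK /scs_M mul_block_col inner_col_mx col_mxKu mul0mx addr0.
rewrite innerDl mulNmx innerNl (inner_mulmxl A^T) trmxK.
by rewrite (innerC (dsubmx u)) addrK innerC.
Qed.

Lemma scs_M_unit (Q : 'M[R]_n) : psd Q -> scs_M Q A + 1%:M \in unitmx.
Proof.
move=> [_ Qge0]; apply: unitmx_inj => v /(congr1 (inner^~ v)).
rewrite mulmxDl mul1mx innerDl scs_M_inner inner0l => Qv.
apply: inner_eq0; have := Qge0 (usubmx v); have := inner_ge0 v; lra.
Qed.

Lemma psd0 : psd (0 : 'M[R]_n).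
Proof. by split=> [|x]; rewrite ?trmx0 // mul0mx inner0r. Qed.

Lemma qcp_f_in w : qcp_affine A b w -> f w = (obj (usubmx w))%:E.
Proof. by move=> wA; rewrite /qcp_f indicator_in ?adde0. Qed.

Lemma qcp_f_out w : ~ qcp_affine A b w -> f w = +oo%E.
Proof. by move=> wA; rewrite /qcp_f indicator_out ?addey. Qed.

Lemma edom_qcp_f : edom f = qcp_affine A b.
Proof.
apply/seteqP; split=> w; rewrite /edom /=; last first.
  by move=> wA; rewrite qcp_f_in // ltry.
by have [//|/qcp_f_out ->] := pselect (qcp_affine A b w); rewrite ltxx.
Qed.

Lemma qcp_affineP x : qcp_affine A b (col_mx x (b - A *m x)).
Proof. by rewrite /qcp_affine /= col_mxKu col_mxKd addrC subrK. Qed.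

Lemma closed_qcp_affine : closed (qcp_affine A b).
Proof.
pose B : 'M[R]_(m, n + m) := row_mx A 1%:M.
rewrite (_ : qcp_affine A b = (mulmx B : 'cV[R]_(n + m) -> _) @^-1` [set b]).
  apply: (continuous_closedP (mulmx B : 'cV[R]_(n + m) -> _)).1.
    exact: mulmx_continuous.
  apply: accessible_closed_set1; apply: hausdorff_accessible.
  exact: norm_hausdorff.
have BE w : B *m w = A *m usubmx w + dsubmx w.
  by rewrite -{1}[w]vsubmxK mul_row_col mul1mx.
by apply/seteqP; split=> w; rewrite /qcp_affine /= BE.
Qed.

Lemma rec_cone_qcp_affine : rec_cone (qcp_affine A b) = qcp_affine A 0.
Proof.
apply/seteqP; split=> w.
  move=> /(_ _ (qcp_affineP 0)); rewrite /qcp_affine /= !linearD /=.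
  rewrite col_mxKu col_mxKd !mulmx0 addr0 subr0 addrA => /eqP.
  by rewrite -subr_eq0 addrK => /eqP.
move=> w0 v; rewrite /qcp_affine /= => vb.
by rewrite !linearD /= addrACA w0 vb add0r.
Qed.

(** The projected point is written as the image of (x, mu) under the system matrix with [P] replaced
    by 0. The residual (A^T mu, mu) is orthogonal to the subspace A x + z = 0. *)
Lemma proj_qcp_affine0 x mu :
  proj (qcp_affine A 0) (col_mx (x + A^T *m mu) (mu - A *m x)) =
  [set col_mx x (- (A *m x))].
Proof.
have diffE : col_mx (x + A^T *m mu) (mu - A *m x) - col_mx x (- (A *m x)) =
    col_mx (A^T *m mu) mu.
  by rewrite opp_col_mx add_col_mx opprK addrAC subrr add0r subrK.
have orth w : qcp_affine A 0 w -> inner (col_mx (A^T *m mu) mu) w = 0.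
  rewrite /qcp_affine /= => w0; rewrite -[w]vsubmxK inner_col_mx inner_mulmxl.
  by rewrite trmxK -innerDr w0 inner0r.
have yA : qcp_affine A 0 (col_mx x (- (A *m x))).
  by rewrite /qcp_affine /= col_mxKu col_mxKd subrr.
apply: proj_cone_eq => //; rewrite diffE; first exact: orth.
by move=> w wA; rewrite innerC orth.
Qed.

(** The increment of [f] in this direction is affine in the base point, with slope P x in its first
    block, so it is bounded only when P x = 0. *)
Lemma rec_qcp_f x : rec_fun f (col_mx x (- (A *m x))) =
  if P *m x == 0 then (inner c x)%:E else +oo%E.
Proof.
have stepE w : qcp_affine A b w -> (f (w + col_mx x (- (A *m x))) - f w)%E =
    (2^-1 * inner x (P *m x) + inner (usubmx w) (P *m x) + inner c x)%:E.
  move=> wA; rewrite !qcp_f_in //; last first.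
    rewrite /qcp_affine /= !linearD /= col_mxKu col_mxKd addrACA subrr.
    by rewrite addr0.
  rewrite -EFinB linearD /= col_mxKu mulmxDr !inner_simp; congr (_%:E).
  have -> : inner x (P *m usubmx w) = inner (usubmx w) (P *m x).
    by rewrite inner_mulmxr P_psd.1 innerC.
  by field.
rewrite /rec_fun edom_qcp_f; case: eqP => Px; last first.
  apply/eqyP => r _; apply: ereal_sup_ubound.
  have Px0 : inner (P *m x) (P *m x) != 0 by apply/eqP => /inner_eq0.
  (* Solves for the multiple of P x at which the increment is exactly [r]; the second block of the
     witness makes it feasible. *)
  pose t := (r - 2^-1 * inner x (P *m x) - inner c x) / inner (P *m x) (P *m x).
  exists (col_mx (t *: (P *m x)) (b - A *m (t *: (P *m x)))).
    exact: qcp_affineP.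
  rewrite stepE; last exact: qcp_affineP.
  by rewrite col_mxKu innerZl mulfVK //; congr (_%:E); ring.
apply/eqP; rewrite eq_le; apply/andP; split.
  apply: ge_ereal_sup => _ [w wA <-].
  by rewrite stepE // Px !inner0r mulr0 !add0r.
apply: ereal_sup_ubound; exists (col_mx 0 (b - A *m 0)); first exact: qcp_affineP.
rewrite stepE; last exact: qcp_affineP.
by rewrite Px !inner0r mulr0 !add0r.
Qed.

(* A vector orthogonal to the direction space of the affine constraint is
   constant on it, so it shifts the conjugate by that constant. *)
Lemma conjugate_qcp_f_add u mu :
  conjugate f (u + col_mx (A^T *m mu) mu) = (conjugate f u + (inner b mu)%:E)%E.
Proof.
have termE w : ((inner w (u + col_mx (A^T *m mu) mu))%:E - f w)%E =
    ((inner w u)%:E - f w + (inner b mu)%:E)%E.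
  have [wA|wA] := pselect (qcp_affine A b w); last first.
    by rewrite qcp_f_out //= addeNy.
  rewrite qcp_f_in // -!EFinB -EFinD; congr (_%:E).
  have -> : inner w (u + col_mx (A^T *m mu) mu) = inner w u + inner b mu.
    rewrite innerDr -{2}[w]vsubmxK inner_col_mx inner_mulmxr trmxK -innerDl.
    by rewrite wA.
  by ring.
apply/eqP; rewrite eq_le; apply/andP; split.
  apply: ge_ereal_sup => _ [w _ <-]; rewrite termE leeD2r //.
  by apply: ereal_sup_ubound; exists w.
rewrite -leeBrDr //; apply: ge_ereal_sup => _ [w _ <-]; rewrite leeBrDr // -termE.
by apply: ereal_sup_ubound; exists w.
Qed.

(** The conjugate grows by the same constant at every point of its domain. It remains to see that
    its values there are finite, so that they cancel, and that the domain is nonempty. *)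
Lemma rec_conjugate_qcp_f mu :
  rec_fun (conjugate f) (col_mx (A^T *m mu) mu) = (inner b mu)%:E.
Proof.
have finite u : edom (conjugate f) u -> conjugate f u \is a fin_num.
  rewrite /edom /= => uoo; rewrite fin_numE -ltey uoo andbT -ltNye.
  apply: (@lt_le_trans _ _ ((inner (col_mx 0 (b - A *m 0)) u)%:E -
      f (col_mx 0 (b - A *m 0)))%E).
    by rewrite qcp_f_in ?ltNyr //; exact: qcp_affineP.
  by apply: ereal_sup_ubound; exists (col_mx 0 (b - A *m 0)).
(* At (c, 0) the linear term cancels and the conjugate is a supremum of values - <x, P x> / 2 <=
   0. *)
have dom0 : edom (conjugate f) (col_mx c 0).
  rewrite /edom /=; apply: (@le_lt_trans _ _ 0%E); last exact: ltry.
  apply: ge_ereal_sup => _ [w _ <-].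
  have [wA|wA] := pselect (qcp_affine A b w); last first.
    by rewrite qcp_f_out //= addeNy leNye.
  rewrite qcp_f_in // -EFinB lee_fin -{1}[w]vsubmxK inner_col_mx inner0r.
  by rewrite (innerC _ c); have := P_psd.2 (usubmx w); lra.
have stepE u : edom (conjugate f) u ->
    (conjugate f (u + col_mx (A^T *m mu) mu) - conjugate f u)%E = (inner b mu)%:E.
  by move=> /finite ufin; rewrite conjugate_qcp_f_add [X in (X - _)%E]addeC addeK.
apply/eqP; rewrite eq_le; apply/andP; split.
  by apply: ge_ereal_sup => _ [u uf <-]; rewrite stepE.
by apply: ereal_sup_ubound; exists (col_mx c 0); rewrite ?stepE.
Qed.

(** The second hypothesis is the KKT condition with multiplier [mu]. As the objective is quadratic,
    the excess of a feasible [z] over [u] is computed exactly in [gapE], and it dominates |z - u|^2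
    / 2. *)
Lemma prox_qcp_f w u mu : qcp_affine A b u ->
    w - u = col_mx (P *m usubmx u + c + A^T *m mu) mu ->
  prox f w = [set u].
Proof.
move=> uA wu.
have gapE (z : 'cV[R]_(n + m)) : qcp_affine A b z ->
    obj (usubmx z) + 2^-1 * inner (z - w) (z - w) =
    obj (usubmx u) + 2^-1 * inner (u - w) (u - w) +
    2^-1 * (inner (z - u) (z - u) +
            inner (usubmx z - usubmx u) (P *m (usubmx z - usubmx u))).
  move=> zA.
  (* The multiplier drops out because [z - u] satisfies the homogeneous constraint. *)
  have cross : inner (z - u) (w - u) =
      inner (usubmx z - usubmx u) (P *m usubmx u + c).
    rewrite wu -[z - u]vsubmxK inner_col_mx !linearB /= innerDr inner_mulmxr.
    rewrite trmxK -addrA -innerDl mulmxBr addrACA -opprD zA uA subrr inner0l.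
    by rewrite addr0.
  have Psym : inner (usubmx u) (P *m usubmx z) = inner (usubmx z) (P *m usubmx u).
    by rewrite inner_mulmxr P_psd.1 innerC.
  move: cross; rewrite mulmxBr !inner_simp Psym.
  rewrite (innerC w z) (innerC w u) (innerC u z) !(innerC _ c); lra.
have miny (z : 'cV[R]_(n + m)) : qcp_affine A b z ->
    obj (usubmx u) + 2^-1 * inner (u - w) (u - w) + 2^-1 * inner (z - u) (z - u)
    <= obj (usubmx z) + 2^-1 * inner (z - w) (z - w).
  by move=> /gapE ->; have := P_psd.2 (usubmx z - usubmx u); lra.
apply/seteqP; split=> [z minz|_ -> z]; last first.
  have [zA|zA] := pselect (qcp_affine A b z); last first.
    by rewrite (qcp_f_out zA) addye // leey.
  rewrite !qcp_f_in // -!EFinD lee_fin !enorm_sqr.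
  by have := miny z zA; have := inner_ge0 (z - u); lra.
have zA : qcp_affine A b z.
  apply: contrapT => zA; have := minz u.
  by rewrite (qcp_f_out zA) qcp_f_in // addye // -EFinD leye_eq.
have := minz u; rewrite !qcp_f_in // -!EFinD lee_fin !enorm_sqr => le_zu.
apply/subr0_eq/inner_eq0/eqP; rewrite eq_le inner_ge0 andbT.
by have := miny z zA; lra.
Qed.

End QuadraticStep.

(** * Closed form of the update of Algorithm E for the quadratic objective *)

Section SCSStep.
Context {R : realType} {n m : nat}.
Variables (P : 'M[R]_n) (A : 'M[R]_(m, n)) (c : 'cV[R]_n) (b : 'cV[R]_m).
Hypothesis P_psd : psd P.
Implicit Types (w x : 'cV[R]_(n + m)) (r : R).

Local Notation f := (qcp_f P A c b).
Local Notation q := (scs_q P A c b).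
Local Notation alpha := (1 + inner q q).

Definition scs_v w : 'cV[R]_(n + m) := invmx (scs_M P A + 1%:M) *m w.

Definition scs_beta w r : R := inner q w - 2 * inner q (scs_v w) - r.

Definition scs_gamma w : R := inner (scs_v w - w) (scs_v w).

Definition scs_tau w r : R :=
  (- scs_beta w r + Num.sqrt (scs_beta w r ^+ 2 - 4 * alpha * scs_gamma w)) /
  (2 * alpha).

Definition scs_u w (t : R) : 'cV[R]_(n + m) := scs_v w - t *: q.

(** Translates the SCS pair (x, y) into (x, z) with z = s - y, where [w] is (p, s). *)
Definition embed_x w (t : R) : 'cV[R]_(n + m) :=
  col_mx (usubmx (scs_u w t)) (dsubmx w - dsubmx (scs_u w t)).

Definition embed_xhat w : 'cV[R]_(n + m) :=
  let x := usubmx (invmx (scs_M 0 A + 1%:M) *m w) in col_mx x (- (A *m x)).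

Lemma scs_vK w : (scs_M P A + 1%:M) *m scs_v w = w.
Proof. by rewrite mulKVmx // scs_M_unit. Qed.

(** From (M + I) v = w follows v - w = - M v. *)
Lemma scs_gammaE w :
  scs_gamma w = - inner (usubmx (scs_v w)) (P *m usubmx (scs_v w)).
Proof.
rewrite /scs_gamma -{2}(scs_vK w) mulmxDl mul1mx opprD addrCA subrr addr0.
by rewrite innerNl scs_M_inner.
Qed.

Lemma scs_gamma_eq0 w : scs_gamma w = 0 <-> P *m usubmx (scs_v w) = 0.
Proof.
rewrite scs_gammaE; split=> [/eqP|->]; last by rewrite inner0r oppr0.
by rewrite oppr_eq0 => /eqP /(psd_isotropic P_psd).
Qed.

(* On the kernel of P the matrix M acts as a skew matrix, so the resolvent can
   be moved from q to v and only the pairing of v with (c, b) is left. *)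
Lemma scs_beta_kernel w r : P *m usubmx (scs_v w) = 0 ->
  scs_beta w r = - (inner c (usubmx (scs_v w)) + inner b (dsubmx (scs_v w))) - r.
Proof.
move=> Pv; rewrite /scs_beta; congr (_ - _).
set v := scs_v w in Pv *.
have qE : (scs_M P A + 1%:M) *m q = col_mx c b by rewrite mulKVmx // scs_M_unit.
have -> : inner c (usubmx v) + inner b (dsubmx v) = inner (col_mx c b) v.
  by rewrite -{3}[v]vsubmxK inner_col_mx.
have wE : w = scs_M P A *m v + v by rewrite -{1}(scs_vK w) mulmxDl mul1mx.
have skew : inner (scs_M P A *m q) v = - inner q (scs_M P A *m v).
  rewrite inner_mulmxl -innerNr; congr (inner q _).
  rewrite /scs_M tr_block_mx trmx0 trmxK P_psd.1 linearN /=.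
  rewrite -[v]vsubmxK !mul_block_col Pv !mul0mx !addr0 !add0r opp_col_mx.
  by rewrite !mulNmx opprK.
by rewrite -qE mulmxDl mul1mx innerDl skew {1}wE innerDr; ring.
Qed.

(** Exchanging y and z = s - y preserves <z, s - z>, so [embed_x] may be replaced by u = v - t q;
    multiplying by [t] and expanding gives the polynomial. *)
Lemma scs_rootP w (t r : R) : 0 < t ->
  t - r = inner (embed_x w t) (w - embed_x w t) / t <->
  alpha * t ^+ 2 + scs_beta w r * t + scs_gamma w = 0.
Proof.
move=> t0; have -> : inner (embed_x w t) (w - embed_x w t) =
    inner (scs_u w t) (w - scs_u w t).
  rewrite /embed_x; move: (scs_u w t) => u.
  rewrite -{2}[w]vsubmxK opp_col_mx add_col_mx opprB.
  rewrite [dsubmx w + (_ - dsubmx w)]addrC subrK.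
  rewrite inner_col_mx [in RHS]inner_submx [usubmx (w - u)]linearB.
  by rewrite [dsubmx (w - u)]linearB /= [X in _ + X = _]innerC.
have polyE : t * (t - r) - inner (scs_u w t) (w - scs_u w t) =
    alpha * t ^+ 2 + scs_beta w r * t + scs_gamma w.
  rewrite /scs_u /scs_beta /scs_gamma !inner_simp.
  rewrite (innerC w) (innerC (scs_v w) q); ring.
rewrite -polyE; split=> [->|/eqP]; first by rewrite mulrC mulfVK ?subrr ?gt_eqF.
by rewrite subr_eq0 => /eqP <-; rewrite mulrAC mulfV ?mul1r ?gt_eqF.
Qed.

(** In (M + I) u = w - t (c, b), divided by [t], the second block row is feasibility and the first
    is the KKT condition with multiplier y / t. *)
Lemma prox_embed w (t : R) : 0 < t ->
  prox f (t^-1 *: w) = [set t^-1 *: embed_x w t].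
Proof.
move=> t0; set u := scs_u w t.
have uE : (scs_M P A + 1%:M) *m u = w - t *: col_mx c b.
  by rewrite mulmxBr scs_vK -scalemxAr mulKVmx // scs_M_unit.
move: uE; rewrite -{1}[u]vsubmxK scs_M_mul -{1}[w]vsubmxK scale_col_mx opp_col_mx.
rewrite add_col_mx => /eq_col_mx[u1E u2E].
have t1 : t != 0 by rewrite gt_eqF.
apply: (prox_qcp_f P_psd (mu := t^-1 *: dsubmx u)).
  rewrite /qcp_affine /= !linearZ /= col_mxKu col_mxKd -/u -scalerDr.
  rewrite addrCA -opprB u2E opprB addrCA subrr addr0.
  by rewrite scalerA mulVf // scale1r.
rewrite -scalerBr -{1}[w]vsubmxK opp_col_mx add_col_mx -/u scale_col_mx.
rewrite !linearZ /= col_mxKu opprB [dsubmx w + (_ - dsubmx w)]addrC subrK; congr col_mx.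
rewrite -[usubmx w](subrK (t *: c)) -u1E addrAC addrK !scalerDr scalerA.
by rewrite mulVf // scale1r addrAC.
Qed.

Lemma embed_condition w r :
  (rec_fun f (embed_xhat w) + rec_fun (conjugate f) (w - embed_xhat w)%R
     <= (- r)%:E)%E <-> scs_gamma w = 0 /\ 0 <= scs_beta w r.
Proof.
set v0 := invmx (scs_M 0 A + 1%:M) *m w.
have v0K : (scs_M 0 A + 1%:M) *m v0 = w by rewrite mulKVmx // scs_M_unit //; exact: psd0.
have v0_v : P *m usubmx v0 = 0 -> v0 = scs_v w.
  move=> Pv0; rewrite /scs_v -v0K (@eq_scs_M_mul _ _ _ A _ P) ?mulKmx //.
    exact: scs_M_unit.
  by rewrite mul0mx Pv0.
have v_v0 : P *m usubmx (scs_v w) = 0 -> scs_v w = v0.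
  move=> Pv; rewrite /v0 -{2}(scs_vK w) (@eq_scs_M_mul _ _ _ A _ 0) ?mulKmx //.
    by rewrite scs_M_unit //; exact: psd0.
  by rewrite mul0mx Pv.
have diffE : w - embed_xhat w = col_mx (A^T *m dsubmx v0) (dsubmx v0).
  rewrite /embed_xhat -/v0 -{1}v0K -{1}[v0]vsubmxK scs_M_mul mul0mx add0r.
  by rewrite opp_col_mx add_col_mx addrK opprK subrK.
rewrite diffE rec_conjugate_qcp_f // rec_qcp_f // -/v0.
(* If P does not kill the x part of [v0], the left side is infinite; and gamma = 0 would make [v0]
   equal to v, whose x part P does kill. *)
case: eqP => [Pv0|Pv0]; last first.
  split; first by rewrite addye // leye_eq.
  by move=> [/scs_gamma_eq0 Pv _]; case: Pv0; rewrite -v_v0.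
have v0E := v0_v Pv0; rewrite v0E in Pv0 *.
rewrite scs_beta_kernel // -EFinD lee_fin; split=> [le_r|[_]]; last by lra.
by split; [apply/scs_gamma_eq0|lra].
Qed.

(** An equivalence, because the existence of runs uses one direction and their comparison the
    other. *)
Lemma embed_step_qcp w r xhat x tau :
  embed_step f w r xhat x tau <->
  [/\ xhat = embed_xhat w, x = embed_x w (scs_tau w r) & tau = scs_tau w r].
Proof.
have alpha0 : 0 < alpha by have := inner_ge0 q; lra.
have gamma0 : scs_gamma w <= 0 by rewrite scs_gammaE oppr_le0; exact: P_psd.2.
have [tau_ge0 rootP tau0P] := positive_root (scs_beta w r) alpha0 gamma0.
rewrite -/(scs_tau w r) in tau_ge0 rootP tau0P.
have projE : proj (rec_cone (closure (edom f))) w = [set embed_xhat w].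
  rewrite edom_qcp_f -(closure_id _).1; last exact: closed_qcp_affine.
  rewrite rec_cone_qcp_affine; set v0 := invmx (scs_M 0 A + 1%:M) *m w.
  have {1}-> : w = (scs_M 0 A + 1%:M) *m v0.
    by rewrite mulKVmx // scs_M_unit //; exact: psd0.
  by rewrite -[v0]vsubmxK scs_M_mul mul0mx add0r [A^T *m _ + _]addrC proj_qcp_affine0.
have solE : 0 < scs_tau w r ->
    embed_solutions f w r = [set (embed_x w (scs_tau w r), scs_tau w r)].
  move=> tau0; apply/seteqP; split=> [[y t] [/= t0 [z]]|_ ->].
    rewrite prox_embed // => /set1_eq <- ->; rewrite scalerA divff ?gt_eqF //.
    by rewrite scale1r => /(scs_rootP _ _ t0)/(rootP _ t0) ->.
  split=> //=; last by apply/scs_rootP => //; apply/rootP.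
  exists ((scs_tau w r)^-1 *: embed_x w (scs_tau w r)); first exact: prox_embed.
  by rewrite scalerA divff ?gt_eqF // scale1r.
(* When the root vanishes, P kills the x part of v, so v also solves the system with 0 in place of
   [P]; its second row gives s - y = - A x. *)
have xhatE : scs_tau w r = 0 -> embed_x w (scs_tau w r) = embed_xhat w.
  move=> tau0; rewrite tau0 /embed_x /scs_u scale0r subr0.
  move: tau0 => /tau0P [/scs_gamma_eq0 Pv _].
  have wE := scs_vK w; rewrite -[scs_v w]vsubmxK scs_M_mul Pv in wE.
  rewrite /embed_xhat.
  have -> : invmx (scs_M 0 A + 1%:M) *m w = scs_v w.
    rewrite -{1}(scs_vK w) (@eq_scs_M_mul _ _ _ A _ 0) ?mulKmx //.
      by rewrite scs_M_unit //; exact: psd0.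
    by rewrite mul0mx Pv.
  by rewrite -{2}wE col_mxKd addrAC subrr add0r.
rewrite /embed_step projE; split=> [[/set1_eq <-]|[-> -> ->]].
  case: ifPn => [/embed_condition /tau0P tau0 [-> ->]|ncond].
    by rewrite xhatE.
  have tau0 : 0 < scs_tau w r.
    rewrite lt_neqAle tau_ge0 andbT eq_sym; apply: contra ncond => /eqP.
    by move=> /tau0P/embed_condition.
  by rewrite solE // => /set1_eq[-> ->].
split=> //; case: ifPn => [/embed_condition /tau0P tau0|ncond].
  by rewrite xhatE // tau0.
rewrite solE // lt_neqAle tau_ge0 andbT eq_sym; apply: contra ncond => /eqP.
by move=> /tau0P/embed_condition.
Qed.

End SCSStep.

(** * Existence of the runs and their agreement *)

Section Runs.
Context {R : realType} {n m : nat}.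
Variables (P : 'M[R]_n) (A : 'M[R]_(m, n)) (c : 'cV[R]_n) (b : 'cV[R]_m).
Variables (K : set 'cV[R]_m) (pK : 'cV[R]_m -> 'cV[R]_m).
Hypotheses (P_psd : psd P) (K_closed : closed K) (K0 : K 0) (K_cone : is_cone K).
Hypothesis K_add : forall x y, K x -> K y -> K (x + y).
Hypothesis pKP : forall x, proj K x (pK x).
Implicit Types (x : 'cV[R]_(n + m)) (r tau : R).

Local Notation f := (qcp_f P A c b).
Local Notation g := (qcp_g K : 'cV[R]_(n + m) -> \bar R).

Lemma proj_cylinder (p : 'cV[R]_(n + m)) :
  proj [set w : 'cV[R]_(n + m) | K (dsubmx w)] p
    (col_mx (usubmx p) (pK (dsubmx p))).
Proof.
have [Kp minp] := pKP (dsubmx p); split=> [|w Kw]; first by rewrite /= col_mxKd.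
have := minp _ Kw; rewrite !ler_enorm !(inner_submx (_ - p)) !linearB /=.
rewrite col_mxKu col_mxKd subrr inner0l add0r => /le_trans; apply.
by rewrite lerDr inner_ge0.
Qed.

(** [g] is convertible to the indicator of the cylinder over [K], itself a closed convex cone. *)
Lemma embed_step_qcp_g p r xbar x tau :
  embed_step g p r xbar x tau <->
  let y := col_mx (usubmx p) (pK (dsubmx p)) in
  [/\ xbar = y, x = y & tau = Num.max r 0].
Proof.
apply: (@embed_step_cone _ _ [set w | K (dsubmx w)]).
- by apply: (continuous_closedP _).1 K_closed; exact: dsubmx_continuous.
- by rewrite /= linear0.
- by move=> w t t0 Kw; rewrite /= linearZ; exact: K_cone.
- by move=> u v Ku Kv; rewrite /= linearD; exact: K_add.
- exact: proj_cylinder.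
Qed.

Lemma proj_dual_cone s : proj (dual_cone K) s = [set pK (- s) + s].
Proof.
have [Ky yy py] := proj_coneP K0 K_cone K_add (pKP (- s)).
by have := moreau_dual Ky yy py; rewrite !opprK.
Qed.

Definition E_next (p : 'cV[R]_(n + m)) r : E_iterate R (n + m) :=
  let tau := scs_tau P A c b p r in
  let x := embed_x P A c b p tau in
  let pt := 2 *: x - p in
  let rt := 2 * tau - r in
  let xt := col_mx (usubmx pt) (pK (dsubmx pt)) in
  EIterate p r (embed_xhat A p) x tau pt rt xt xt (Num.max rt 0).

Lemma E_next_iteration p r : E_iteration f g (E_next p r).
Proof. by split=> //=; [apply/embed_step_qcp|apply/embed_step_qcp_g]. Qed.

Definition S_next (p : 'cV[R]_n) (s : 'cV[R]_m) r : S_iterate R n m :=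
  let w := col_mx p s in
  let tau := scs_tau P A c b w r in
  let u := scs_u P A c b w tau in
  let y := dsubmx u in
  SIterate p s r (scs_v P A w) tau (usubmx u) y (2 *: usubmx u - p)
    (pK (- (2 *: y - s)) + (2 *: y - s)) (Num.max (2 * tau - r) 0).

Lemma S_next_iteration p s r : S_iteration P A c b K (S_next p s r).
Proof. by split; rewrite /= ?vsubmxK //; split=> //; exact: proj_dual_cone. Qed.

Lemma E_run_exists p r : exists e, E_run f g p r e.
Proof.
pose next (e : E_iterate R (n + m)) :=
  E_next (E_p e + E_xt e - E_x e) (E_r e + E_taut e - E_tau e).
(* The predecessor accounts for numbering from 1; index 0 merely repeats the first iterate. *)
exists (fun k => iter k.-1 next (E_next p r)); split=> // -[//|k] _.
by split=> //=; case: k => [|k] /=; exact: E_next_iteration.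
Qed.

Lemma S_run_exists p s r : exists e, S_run P A c b K p s r e.
Proof.
pose next (e : S_iterate R n m) := S_next (S_p e + S_xt e - S_x e)
  (S_s e + S_yt e - S_y e) (S_r e + S_taut e - S_tau e).
exists (fun k => iter k.-1 next (S_next p s r)); split=> // -[//|k] _.
by split=> //=; case: k => [|k] /=; exact: S_next_iteration.
Qed.

Lemma iteration_agree (e : E_iterate R (n + m)) (e' : S_iterate R n m) :
    E_iteration f g e -> S_iteration P A c b K e' ->
    E_p e = col_mx (S_p e') (S_s e') -> E_r e = S_r e' ->
  [/\ [/\ usubmx (E_x e) = S_x e', E_tau e = S_tau e',
          usubmx (E_xt e) = S_xt e' & E_taut e = S_taut e'],
      S_y e' = dsubmx (E_p e) - dsubmx (E_x e) &
      S_yt e' = dsubmx (E_xt e) - dsubmx (E_pt e)].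
Proof.
move=> [stepf ptE rtE stepg] [vE tauE xyE [xtE ytE tautE]] pE rE.
move: stepf stepg => /(embed_step_qcp _ _ _ P_psd)[_ xE tE].
move=> /embed_step_qcp_g[_ xtE' tautE'].
have tau_eq : E_tau e = S_tau e'.
  by rewrite tE tauE vE pE rE.
have uE : scs_u P A c b (E_p e) (E_tau e) = col_mx (S_x e') (S_y e').
  by rewrite xyE /scs_u /scs_v vE tau_eq pE.
have {}xE : E_x e = col_mx (S_x e') (S_s e' - S_y e').
  by rewrite xE -tE /embed_x uE pE !col_mxKu !col_mxKd.
(* With z = s - y, the reflection 2 z - s is the negative of 2 y - s, so Moreau's decomposition
   links the projections onto [K] and its dual cone. *)
have {}ptE : E_pt e = col_mx (2 *: S_x e' - S_p e') (- (2 *: S_y e' - S_s e')).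
  rewrite ptE xE pE scale_col_mx opp_col_mx add_col_mx; congr col_mx.
  by apply/colP => i; rewrite !mxE; ring.
rewrite xE pE xtE' ptE !col_mxKu !col_mxKd; split.
- by split=> //; rewrite ?xtE // tautE' rtE tau_eq rE tautE.
- by rewrite opprB addrC subrK.
- by rewrite opprK; move: ytE; rewrite proj_dual_cone => /set1_eq.
Qed.

(** The s updates agree since, writing zt, st, yt for the tilde vectors, st = 2 z - s gives yt - y =
    (zt - st) - (s - z) = zt - z. *)
Lemma runs_agree p s r e e' :
    E_run f g (col_mx p s) r e -> S_run P A c b K p s r e' ->
  forall k, (1 <= k)%N -> E_p (e k) = col_mx (S_p (e' k)) (S_s (e' k)) /\
                          E_r (e k) = S_r (e' k).
Proof.
move=> [p1E r1E eS] [p1E' s1E' r1E' e'S]; elim=> // -[_ _|k IH _].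
  by rewrite p1E r1E p1E' s1E' r1E'.
have [pE rE] := IH isT.
have [itE -> ->] := eS k.+1 isT; have [itS -> -> ->] := e'S k.+1 isT.
have [[xE tauE xtE tautE] yE ytE] := iteration_agree itE itS pE rE.
split; last by rewrite rE tauE tautE.
have ptE : E_pt (e k.+1) = 2 *: E_x (e k.+1) - E_p (e k.+1) by case: itE.
rewrite -[LHS]vsubmxK; congr col_mx.
  by rewrite !linearB !linearD /= xE xtE pE col_mxKu.
rewrite yE ytE ptE !linearB /= !linearD /= linearZ /= pE col_mxKd.
move: (dsubmx _) (dsubmx _) => a a'.
by rewrite scaler_nat mulr2n; apply/colP => i; rewrite !mxE; ring.
Qed.

End Runs.

Theorem mainTheorem5 (R : realType) (n m : nat)
    (P : 'M[R]_n) (A : 'M[R]_(m, n)) (c : 'cV[R]_n) (b : 'cV[R]_m)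
    (K : set 'cV[R]_m)
    (P_psd : psd P)
    (K_nonempty : K !=set0) (K_closed : closed K)
    (K_convex : @convex_set R 'cV[R]_m K) (K_cone : is_cone K)
    (p1 : 'cV[R]_n) (s1 : 'cV[R]_m) (r1 : R) :
  [/\ (exists e : nat -> E_iterate R (n + m),
         E_run (qcp_f P A c b) (qcp_g K) (col_mx p1 s1) r1 e),
      (exists e : nat -> S_iterate R n m, S_run P A c b K p1 s1 r1 e) &
      forall (e : nat -> E_iterate R (n + m)) (e' : nat -> S_iterate R n m),
        E_run (qcp_f P A c b) (qcp_g K) (col_mx p1 s1) r1 e ->
        S_run P A c b K p1 s1 r1 e' ->
        forall k : nat, (1 <= k)%N ->
          [/\ [/\ usubmx (E_p (e k)) = S_p (e' k),
                  dsubmx (E_p (e k)) = S_s (e' k) &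
                  E_r (e k) = S_r (e' k)],
              [/\ usubmx (E_x (e k)) = S_x (e' k),
                  E_tau (e k) = S_tau (e' k),
                  usubmx (E_xt (e k)) = S_xt (e' k) &
                  E_taut (e k) = S_taut (e' k)],
              S_y (e' k) = dsubmx (E_p (e k)) - dsubmx (E_x (e k)) &
              S_yt (e' k) = dsubmx (E_xt (e k)) - dsubmx (E_pt (e k))]].
Proof.
have K0 : K 0 by exact: cone_closed0.
have K_add := cone_add_closed K_cone K_convex.
(* A projection is selected at every point, so that the iterates can be given explicitly. *)
have /choice[pK pKP] : forall x, exists y, proj K x y.
  by move=> x; exact: proj_nonempty.
split; first exact: E_run_exists.
  exact: S_run_exists.
move=> e e' eE e'S k k1.
have [pE rE] := runs_agree P_psd K_closed K0 K_cone K_add pKP eE e'S k1.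
have [_ _ /(_ k k1)[itE _ _]] := eE; have [_ _ _ /(_ k k1)[itS _ _ _]] := e'S.
have [agree yE ytE] :=
  iteration_agree P_psd K_closed K0 K_cone K_add pKP itE itS pE rE.
by split=> //; rewrite pE col_mxKu col_mxKd.
Qed.
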